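(* Let $(X,T)$ be a minimal dynamical system, $d\in\mathbb{N}$, and let $(x_0,x_1)\in\mathbf{RP}^{[d]}(X)$ with $x_0\neq x_1$. If $(x_0,x_1)$ is a $T\times T$-minimal point (a minimal point of the system $(X\times X,T\times T)$), then $(x_0,x_1)$ is an $\mathrm{IN}^{[d]}$-pair.
   Context: $\mathbb{N}$ denotes the set of positive integers. A dynamical system $(X,T)$ is a compact metric space $X$ with metric $\rho$ together with a homeomorphism $T:X\to X$. It is minimal if every point has dense orbit $\{T^nx:n\in\mathbb{Z}\}$. A point of a dynamical system is minimal if its orbit closure, with the restricted transformation, is a minimal system. For $\vec n\in\mathbb{Z}^d$ and $\epsilon\in\{0,1\}^d$ write $\vec n\cdot\epsilon=\sum_{i=1}^d n_i\epsilon(i)$. The regionally proximal relation of order $d$: $(x,y)\in\mathbf{RP}^{[d]}(X)$ if and only if for every $\delta>0$ there exist $x',y'\in X$ and $\vec n\in\mathbb{Z}^d$ such that $\rho(x,x')<\delta$, $\rho(y,y')<\delta$ and $\rho(T^{\vec n\cdot\epsilon}x',T^{\vec n\cdot\epsilon}y')<\delta$ for all $\epsilon\in\{0,1\}^d\setminus\{\vec 0\}$. For subsets $U_0,U_1\subset X$, a set $F\subset\mathbb{Z}$ is an independence set for $(U_0,U_1)$ if for every nonempty finite $J\subset F$ and every $s=(s(j):j\in J)\in\{0,1\}^J$ we have $\bigcap_{j\in J}T^{-j}U_{s(j)}\neq\emptyset$. A pair $(x_0,x_1)\in X\times X$ is an $\mathrm{IN}^{[d]}$-pair if for any $k\in\mathbb{N}$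 and any neighborhoods $U_0,U_1$ of $x_0$ and $x_1$ respectively, there exist integers $p_j^{(i)}$, $1\leq i\leq k$, $1\leq j\leq d$, such that the $k(2^d-1)$ integers $p_1^{(i)}\epsilon(1)+\ldots+p_d^{(i)}\epsilon(d)$ ($1\leq i\leq k$, $\epsilon\in\{0,1\}^d\setminus\{\vec 0\}$) are nonzero and pairwise distinct and the set of all of them is an independence set for $(U_0,U_1)$. *)

(* Defs.v *)
From HB Require Import structures.
From mathcomp Require Import all_boot all_order all_algebra.
From mathcomp Require Import all_classical all_reals all_analysis.
Set Implicit Arguments.
Unset Strict Implicit.
Unset Printing Implicit Defensive.
Import Order.TTheory GRing.Theory Num.Theory.
Local Open Scope classical_set_scope.
Local Open Scope ring_scope.

Record homeo (X : topologicalType) := Homeo {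
  homeo_fun :> X -> X;
  homeo_inv : X -> X;
  homeo_continuous : continuous homeo_fun;
  homeo_inv_continuous : continuous homeo_inv;
  homeoK : cancel homeo_fun homeo_inv;
  homeo_invK : cancel homeo_inv homeo_fun }.

Section HomeoSquare.
Variables (X : topologicalType) (T : homeo X).

Definition square_map (f : X -> X) (u : X * X) : X * X := (f u.1, f u.2).

Lemma square_map_continuous (f : X -> X) :
  continuous f -> continuous (square_map f).
Proof.
move=> cf u; apply: (@cvg_pair _ _ _ _ (nbhs (f u.1)) (nbhs (f u.2))).
  by apply: cvg_comp; [exact: cvg_fst | exact: cf].
by apply: cvg_comp; [exact: cvg_snd | exact: cf].
Qed.

Lemma square_mapK (f g : X -> X) :
  cancel f g -> cancel (square_map f) (square_map g).
Proof. by move=> fK [x y]; rewrite /square_map /= !fK. Qed.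

Definition homeo_square : homeo (X * X)%type :=
  Homeo (square_map_continuous (@homeo_continuous _ T))
        (square_map_continuous (@homeo_inv_continuous _ T))
        (square_mapK (@homeoK _ T))
        (square_mapK (@homeo_invK _ T)).
End HomeoSquare.

Section Dynamics.
Variables (X : topologicalType) (T : homeo X).

Definition iterz (n : int) : X -> X :=
  match n with
  | Posz m => iter m T
  | Negz m => iter m.+1 (homeo_inv T)
  end.

Definition orbitz (x : X) : set X := [set iterz n x | n in [set: int]].

(* The system (A, T|A), for A a closed invariant set, is minimal: every orbit
   of a point of A is dense in the subspace A. *)
Definition minimal_on (A : set X) : Prop :=
  forall y, A y -> A `<=` closure (orbitz y).

Definition minimal_system : Prop := minimal_on [set: X].

Definition minimal_point (x : X) : Prop := minimal_on (closure (orbitz x)).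

(* Only the values of s on J are used, so quantifying over total
   s : int -> bool is the same as over {0,1}^J (false = 0, true = 1). *)
Definition independence_set (U0 U1 : set X) (F : set int) : Prop :=
  forall J : set int, finite_set J -> J !=set0 -> J `<=` F ->
  forall s : int -> bool,
    \bigcap_(j in J) (iterz j @^-1` (if s j then U1 else U0)) !=set0.
End Dynamics.

Definition cube (d : nat) := {ffun 'I_d -> bool}.

Definition cube0 (d : nat) : cube d := [ffun=> false].

Definition cube_dot (d : nat) (n : 'I_d -> int) (eps : cube d) : int :=
  \sum_(i < d) n i * (eps i)%:Z.

Definition RP (R : realType) (X : metricType R) (T : homeo X) (d : nat)
    (x y : X) : Prop :=
  forall delta : R, 0 < delta ->
  exists (x' y' : X) (n : 'I_d -> int),
    [/\ mdist x x' < delta,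
        mdist y y' < delta
      & forall eps : cube d, eps != cube0 d ->
          mdist (iterz T (cube_dot n eps) x')
                (iterz T (cube_dot n eps) y') < delta].

Definition IN_pair (X : topologicalType) (T : homeo X) (d : nat)
    (x0 x1 : X) : Prop :=
  forall k : nat, (0 < k)%N ->
  forall U0 U1 : set X, nbhs x0 U0 -> nbhs x1 U1 ->
  exists p : 'I_k -> 'I_d -> int,
    let D := [set u : 'I_k * cube d | u.2 != cube0 d] in
    let q := fun u : 'I_k * cube d => cube_dot (p u.1) u.2 in
    [/\ forall u, D u -> q u != 0,
        forall u v, D u -> D v -> q u = q v -> u = v
      & independence_set T U0 U1 (q @` D)].

(* Main.v *)
Require Import Defs.
From HB Require Import structures.
From mathcomp Require Import all_boot all_order all_algebra.
From mathcomp Require Import all_classical all_reals all_analysis.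
From mathcomp Require Import zify ring.
Set Implicit Arguments.
Unset Strict Implicit.
Unset Printing Implicit Defensive.
Import Order.TTheory GRing.Theory Num.Theory.
Local Open Scope classical_set_scope.
Local Open Scope ring_scope.

(** Write S = T x T, a = (x0, x1) and A for the orbit closure of a, a minimal
    set of S.  The relation RP^[d] is closed and invariant, so every point of A
    is an RP^[d]-pair.

    Reduction to flipping one vertex.  Suppose that for every vertex e of the
    d-cube and all neighbourhoods V0, V1 of x0, x1 there are a direction vector
    N and two cubes (S^{N.v} q)_v of points of A, with this same N, all of whose
    vertices lie in V0 x V1, except that at e one only asks the first
    coordinate to lie in V0 for one of the cubes and in V1 for the other
    (vertex_flip).  Such flips can be superposed: a pattern that has been
    realized along the orbit of a is an open condition on the pair a, and it
    survives if a is replaced by a vertex of a much finer flip, since the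
    latter is again close to a.  At the vertex e the finer flip exchanges x0 for
    x1, which frees the symbol at e.  Going through all nonzero vertices of k
    cubes gives every pattern at once (independent_cubes).  When V0 and V1 are
    disjoint, two coinciding exponents, or one equal to 0, would have to carry
    two different symbols, so distinctness comes for free.

    Flipping one vertex amounts to lifting an RP^[d]-pair of X to A: one needs
    w, w' in A such that the first coordinate of w' is close to the second
    coordinate of w, while S^{N.v} w and S^{N.v} w' are close for v <> 0.  Once w
    has been shifted into V0 x V1, the first coordinate of w' is in V1, and it
    remains to bring the other vertices of both cubes back into V0 x V1.

    Two ideas are used.  First, constant cubes are uniformly recurrent under
    face transformations: if y is a minimal point and B a neighbourhood of y,
    then the n in Z^d with S^{n.v} y in B for all v form a syndetic set.  Indeed,
    if u is an idempotent in a minimal left ideal of the enveloping semigroup and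
    u y = y, then the transformation equal to the identity at the vertex 0 and to
    u at every other vertex belongs to a minimal left ideal of the enveloping
    semigroup of the face group (face_returns, minimal_point_cube_syndetic).  The
    syndeticity constants depend on y; by Baire's theorem there is a point b of A
    near which they can be chosen locally uniformly, and at which moreover the
    projection of A to X is open (good_point_exists).

    Secondly, put x = b.1 and consider (d+1)-dimensional cubes in A whose base
    point has second coordinate close to x, and whose other vertices all have
    first coordinate close to x.  The RP^[d] relation provides such a cube with
    one face close to b (collapsed1).  The other faces are then moved onto b one
    after the other (collapsedS).  Recurrence is available near b only, so each
    of these moves is organized around a vertex that already is close to b; this
    displaces the base point of the cube, but by a power of S that brings x back
    to x, so that the second coordinate of the base point stays close to x.  In
    the end all vertices but the base point are close to b, and the two halves
    of the cube are the two required d-cubes (one_vertex_flip). *)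

(** * Compactness and Zorn's lemma *)

Section CompactFamilies.

Lemma nbhs_forall (T : topologicalType) (I : finType) (P : I -> set T) (x : T) :
  (forall i, nbhs x (P i)) -> nbhs x [set y | forall i, P i y].
Proof. by move=> Px; exact: filter_forall. Qed.

Lemma compact_finite_cover (T : topologicalType) (I : eqType) (K : set T)
    (P : I -> set T) :
  compact K -> (forall x, K x -> exists i, nbhs x (P i)) ->
  exists s : seq I, forall x, K x -> exists2 i, i \in s & P i x.
Proof.
move=> /compact_near_coveringP cK cov.
pose F : set_system (seq I) :=
  filter_from [set: seq I] (fun s0 : seq I => [set s : seq I | {subset s0 <= s}]).
have FF : ProperFilter F.
  apply: filter_from_proper; last by move=> s _; exists s.
  apply: filter_from_filter; first by exists [::].
  move=> s t _ _; exists (s ++ t) => // r /= rst.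
  by split=> i si; apply: rst; rewrite mem_cat si ?orbT.
have : \forall s \near F, K `<=` (fun x => exists2 i, i \in s & P i x).
  apply: cK => x /cov[i Pi].
  exists (P i, [set s : seq I | i \in s]) => /=.
    by split=> //; exists [:: i] => // s /= sub; apply: sub; rewrite inE.
  by move=> [y s] /= [Piy si]; exists i.
by move=> /(@filter_ex _ F FF)[s sK]; exists s => x /sK.
Qed.

Lemma compact_chain_nonempty (T : topologicalType) (F : set (set T)) :
  hausdorff_space T -> F !=set0 -> total_on F subset ->
  (forall A, F A -> A !=set0 /\ compact A) ->
  (\bigcap_(A in F) A !=set0) /\ compact (\bigcap_(A in F) A).
Proof.
move=> hT [A0 FA0] totF FP.
have clF A : F A -> closed A by move=> /FP[_ cA]; exact: compact_closed.
split; last first.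
  apply: (@subclosed_compact _ _ A0); last by move=> x; exact.
    exact: closed_bigI.
  by case: (FP _ FA0).
have PF : ProperFilter (filter_from F id).
  apply: filter_from_proper; last by move=> A /FP[].
  apply: filter_from_filter; first by exists A0.
  move=> A B FA FB; have [AB|BA] := totF _ _ FA FB.
    by exists A => // x Ax; split=> //; exact: AB.
  by exists B => // x Bx; split=> //; exact: BA.
have [_ cA0] := FP _ FA0.
have [p [_ clp]] : A0 `&` cluster (filter_from F id) !=set0.
  by apply: cA0; exists A0.
exists p => A FA; apply: (clF _ FA) => B Bp.
by apply: clp => //; exists A.
Qed.

(** Zorn's lemma downwards: the union-closed family it is applied to consists
    of the complements within C. *)
Lemma minimal_set_exists (T : Type) (P : set (set T)) (C : set T) :
  P C ->
  (forall F : set (set T), F !=set0 -> F `<=` P -> total_on F subset ->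
     P (\bigcap_(A in F) A)) ->
  exists M, [/\ M `<=` C, P M & forall N, N `<=` M -> P N -> N = M].
Proof.
move=> PC chain; pose Q := [set B | P (C `\` B)].
have [|B [QB maxB]] := @Zorn_bigcup T Q.
  move=> F FQ totF.
  have [->|/set0P[B0 FB0]] := eqVneq F set0.
    by rewrite bigcup_set0 /Q /= setD0.
  pose G := [set C `\` B | B in F].
  suff : P (\bigcap_(A in G) A).
    congr (P _); apply/seteqP; split => x.
      move=> Gx; split; first by have [] : (C `\` B0) x by apply: Gx; exists B0.
      by move=> [B FB Bx]; have [] : (C `\` B) x by apply: Gx; exists B.
    by move=> [Cx nFx] _ [B FB <-]; split=> // Bx; apply: nFx; exists B.
  apply: chain; first by exists (C `\` B0), B0.
    by move=> _ [B FB <-]; exact: FQ.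
  move=> _ _ [B FB <-] [B' FB' <-].
  by have [BB|BB] := totF _ _ FB FB'; [right|left]; exact: setDS.
exists (C `\` B); split=> // N NCB PN.
have CN : C `\` ~` N = N.
  by rewrite setDE setCK setIC; apply: setIidl => x /NCB[].
apply: contrapT => NneC; apply: (maxB (~` N)); last by rewrite /Q /= CN.
rewrite properEneq; split; last by move=> x Bx /NCB[].
by apply/eqP => BN; apply: NneC; rewrite BN CN.
Qed.

End CompactFamilies.

(** * Idempotents in compact right topological semigroups *)

Section EllisSemigroups.
Variables (S : topologicalType) (op : S -> S -> S).
Hypothesis hS : hausdorff_space S.
Hypothesis opA : associative op.
Hypothesis op_cont : forall s, continuous (op^~ s).

Definition subsemigroup (C : set S) := forall x y, C x -> C y -> C (op x y).

(** The right factor is moved to the closure first, with the left factor in G,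
    because left translations are continuous for elements of G only. *)
Lemma closure_subsemigroup (G : set S) :
  subsemigroup G -> (forall g, G g -> continuous (op g)) ->
  subsemigroup (closure G).
Proof.
move=> GG contG.
have step (f : S -> S) : continuous f -> (forall x, G x -> closure G (f x)) ->
    forall x, closure G x -> closure G (f x).
  move=> /continuous_closedP/(_ _ (@closed_closure _ G))/closure_id fG Gf x Gx.
  by have : (f @^-1` closure G) x by rewrite fG; apply: (closureS _ Gx) => y /Gf.
move=> x y Gx Gy; apply: (step (op^~ y)) => // {x Gx} x Gx.
apply: (step (op x)) => //; first exact: contG.
by move=> {y Gy} y Gy; apply: subset_closure; exact: GG.
Qed.

(** Ellis-Numakura: let M be a minimal compact subsemigroup and x in M.  Both
    M x and the set of the y in M with y x = x are compact subsemigroups, so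
    they equal M, and the latter contains x. *)
Lemma idempotent_exists (C : set S) :
  C !=set0 -> compact C -> subsemigroup C ->
  exists2 e, C e & op e e = e.
Proof.
move=> C0 cC CC.
pose P := [set X | [/\ X !=set0, compact X & subsemigroup X]].
have [||M [MC [M0 cM MM] minM]] := @minimal_set_exists _ P C.
- by split.
- move=> F F0 FP totF.
  have [X Y] : (\bigcap_(A in F) A !=set0) /\ compact (\bigcap_(A in F) A).
    by apply: compact_chain_nonempty => // A /FP[].
  split=> // x y Fx Fy A FA; have [_ _ AA] := FP _ FA.
  by apply: AA; [exact: Fx|exact: Fy].
have [x Mx] := M0; exists x; first exact: MC.
have Mimg : op^~ x @` M = M.
  apply: minM; first by move=> _ [y My <-]; exact: MM.
  split; first by exists (op x x), x.
    apply: continuous_compact => //; apply: continuous_subspaceT.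
    exact: op_cont.
  move=> _ _ [y My <-] [z Mz <-]; exists (op (op y x) z).
    exact: MM (MM _ _ My Mx) Mz.
  by rewrite !opA.
have fixM : M `&` (op^~ x @^-1` [set x]) = M.
  apply: minM; first by move=> y [].
  split.
  - have : M x by []. by rewrite -{1}Mimg => -[y My yx]; exists y.
  - apply: compact_closedI => //; apply: closed_comp => [? _|].
      exact: op_cont.
    by apply: compact_closed => //; exact: compact_set1.
  - move=> y z [My /= yx] [Mz /= zx]; split; first exact: MM.
    by rewrite /= -opA zx.
by have [] : (M `&` (op^~ x @^-1` [set x])) x by rewrite fixM.
Qed.

Variable U : set S.
Hypotheses (U0 : U !=set0) (cU : compact U) (UU : subsemigroup U).

Definition left_ideal (L : set S) :=
  [/\ L !=set0, compact L, L `<=` U & forall s l, U s -> L l -> L (op s l)].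

(** Equivalently, L contains no smaller left ideal: L = U l for all l in L. *)
Definition minimal_left_ideal (L : set S) :=
  left_ideal L /\ forall l, L l -> L `<=` op^~ l @` U.

Lemma left_ideal_principal (s : S) : U s -> left_ideal (op^~ s @` U).
Proof.
move=> Us; split.
- by have [u Uu] := U0; exists (op u s), u.
- apply: continuous_compact => //; apply: continuous_subspaceT.
  exact: op_cont.
- by move=> _ [u Uu <-]; exact: UU.
- move=> t _ Ut [u Uu <-]; exists (op t u); first exact: UU.
  by rewrite opA.
Qed.

Lemma minimal_left_ideal_exists (J : set S) :
  left_ideal J -> exists2 L, L `<=` J & minimal_left_ideal L.
Proof.
move=> idJ.
have [|L [LJ idL minL]] := @minimal_set_exists _ left_ideal J idJ.
  move=> F F0 FP totF.
  have [X Y] : (\bigcap_(A in F) A !=set0) /\ compact (\bigcap_(A in F) A).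
    by apply: compact_chain_nonempty => // A /FP[].
  split=> //.
    move=> x Fx; have [A FA] := F0; have [_ _ + _] := FP _ FA; apply.
    exact: Fx.
  by move=> s l Us Fl A FA; have [_ _ _] := FP _ FA; apply => //; exact: Fl.
exists L => //; split=> // l Ll x Lx.
have [_ _ LU LL] := idL.
by rewrite (minL (op^~ l @` U))//; [move=> _ [u Uu <-]; exact: LL|
  exact/left_ideal_principal/LU].
Qed.

(** The idempotents of a minimal left ideal are right identities of it, because
    the ideal is U e for each of them. *)
Lemma minimal_left_ideal_idem (L : set S) (u e : S) :
  minimal_left_ideal L -> L u -> L e -> op e e = e -> op u e = u.
Proof.
by move=> [_ minL] Lu Le ee; have [s Us <-] := minL _ Le _ Lu; rewrite -opA ee.
Qed.

End EllisSemigroups.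

(** * Integer iterates of a homeomorphism *)

Section IterzTheory.
Variables (Z : topologicalType) (T : homeo Z).

Lemma iterzS (n : int) (x : Z) : iterz T (1 + n) x = T (iterz T n x).
Proof.
case: n => [n|[|n]]; first by rewrite -PoszD.
  by rewrite [1 + _]addrC /= homeo_invK.
by rewrite (_ : 1 + Negz n.+1 = Negz n) ?NegzE; [rewrite /= homeo_invK|lia].
Qed.

Lemma iterzD (m n : int) (x : Z) :
  iterz T (m + n) x = iterz T m (iterz T n x).
Proof.
elim: m n x => [n x|m IH n x|m IH n x]; first by rewrite add0r.
  by rewrite (_ : m.+1%:Z = 1 + m%:Z) -?addrA ?iterzS ?IH //; lia.
apply: (can_inj (@homeoK _ T)); rewrite -!iterzS.
rewrite (_ : 1 + (- m.+1%:Z + n) = - m%:Z + n); last by lia.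
by rewrite (_ : 1 - m.+1%:Z = - m%:Z); last by lia.
Qed.

Lemma iterz_continuous (n : int) : continuous (iterz T n).
Proof.
have it (f : Z -> Z) : continuous f -> forall k, continuous (iter k f).
  move=> cf; elim=> [|k IH] x; first exact: cvg_id.
  by apply: (continuous_comp (IH x)); exact: cf.
case: n => n; apply: it; first exact: homeo_continuous.
exact: homeo_inv_continuous.
Qed.

End IterzTheory.

(** * Uniform recurrence of constant cubes *)

Section CubeDot.
Variable d : nat.

Lemma cube_dotD (n m : 'I_d -> int) (eps : cube d) :
  cube_dot (fun i => n i + m i) eps = cube_dot n eps + cube_dot m eps.
Proof. by rewrite /cube_dot -big_split; apply: eq_bigr => i _; rewrite mulrDl. Qed.

Lemma cube_dot0r (n : 'I_d -> int) : cube_dot n (cube0 d) = 0.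
Proof. by rewrite /cube_dot big1// => i _; rewrite ffunE mulr0. Qed.

Lemma cube_dot0l (eps : cube d) : cube_dot (fun=> 0) eps = 0.
Proof. by rewrite /cube_dot big1// => i _; rewrite mul0r. Qed.

Lemma cube_dot_single (i : 'I_d) (n : int) (eps : cube d) :
  cube_dot (fun j => if j == i then n else 0) eps = if eps i then n else 0.
Proof.
rewrite /cube_dot (bigD1 i)//= eqxx big1 ?addr0; last first.
  by move=> j /negPf ->; rewrite mul0r.
by case: (eps i); rewrite ?mulr1 ?mulr0.
Qed.

End CubeDot.

Lemma ptws_continuous (X : topologicalType) (I : choiceType)
    (K : topologicalType) (f : X -> {ptws I -> K}) :
  (forall i, continuous (fun x => f x i)) -> continuous f.
Proof.
move=> cf x; apply/cvg_sup => i U [_ /= [[V oV <-]]] /= Vfx sVU.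
by apply: (filterS sVU); apply: cf; exact: open_nbhs_nbhs.
Qed.

Section CubeEnvelopingSemigroup.
Variables (Z : topologicalType) (T : homeo Z) (d : nat).
Hypotheses (cZ : compact [set: Z]) (hZ : hausdorff_space Z).

Notation env := {ptws Z -> Z}.
Notation cenv := {ptws (cube d * Z)%type -> Z}.

Let cop (f g : cenv) : cenv := fun p => f (p.1, g p).
Let eop (f g : env) : env := fun z => f (g z).

Let face_action (n : 'I_d -> int) : cenv :=
  fun p => iterz T (cube_dot n p.1) p.2.

(* ES is the enveloping semigroup of T, and FS that of the group of face
   transformations, acting on the vertices of a cube separately. *)
Let ES : set env := closure [set (iterz T n : env) | n in [set: int]].
Let FS : set cenv := closure [set face_action n | n in [set: 'I_d -> int]].

Let eval_cont (I : choiceType) (i : I) :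
  continuous (fun f : {ptws I -> Z} => f i).
Proof. exact: (@proj_continuous I (fun=> Z) i). Qed.

Let ptws_hausdorff (I : choiceType) : hausdorff_space {ptws I -> Z}.
Proof. by apply: (@hausdorff_product I (fun=> Z)). Qed.

Let ptws_compact (I : choiceType) : compact [set: {ptws I -> Z}].
Proof.
have := @tychonoff I (fun=> Z) (fun=> setT) (fun=> cZ).
by congr compact; apply/seteqP; split.
Qed.

Let cop_cont g : continuous (cop^~ g).
Proof. by apply: ptws_continuous => p; exact: eval_cont. Qed.

Let eop_cont g : continuous (eop^~ g).
Proof. by apply: ptws_continuous => p; exact: eval_cont. Qed.

Let copA : associative cop.
Proof. by move=> f g h; apply/funext => -[]. Qed.

Let eopA : associative eop. Proof. by []. Qed.

Let cFS : compact FS.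
Proof.
exact: (subclosed_compact (@closed_closure _ _) (@ptws_compact _) (@subsetT _ _)).
Qed.

Let cES : compact ES.
Proof.
exact: (subclosed_compact (@closed_closure _ _) (@ptws_compact _) (@subsetT _ _)).
Qed.

Let FS_face n : FS (face_action n).
Proof. by apply: subset_closure; exists n. Qed.

Let ES_iterz n : ES (iterz T n : env).
Proof. by apply: subset_closure; exists n. Qed.

Let FSS : subsemigroup cop FS.
Proof.
apply: closure_subsemigroup => //.
  move=> _ _ [n _ <-] [m _ <-]; exists (fun i => n i + m i) => //.
  by apply/funext => p; rewrite /face_action /cop /= cube_dotD iterzD.
move=> _ [n _ <-]; apply: ptws_continuous => p f.
apply: continuous_comp; first exact: eval_cont.
exact: iterz_continuous.
Qed.

Let ESS : subsemigroup eop ES.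
Proof.
apply: closure_subsemigroup => //.
  move=> _ _ [n _ <-] [m _ <-]; exists (n + m) => //.
  by apply/funext => p; rewrite /eop /= iterzD.
move=> _ [n _ <-]; apply: ptws_continuous => p f.
apply: continuous_comp; first exact: eval_cont.
exact: iterz_continuous.
Qed.

Let closure_cont (X Y : topologicalType) (f : X -> Y) (A : set X) (B : set Y) :
  continuous f -> (forall x, A x -> closure B (f x)) ->
  forall x, closure A x -> closure B (f x).
Proof.
move=> /continuous_closedP/(_ _ (@closed_closure _ B))/closure_id fB AB x Ax.
by have : (f @^-1` closure B) x by rewrite fB; apply: (closureS _ Ax) => y /AB.
Qed.

Let FS_coord eps f : FS f -> ES (fun z => f (eps, z)).
Proof.
apply: (@closure_cont cenv env (fun f => (fun z => f (eps, z)) : env)).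
  by apply: ptws_continuous => z; exact: eval_cont.
by move=> _ [n _ <-]; apply: subset_closure; exists (cube_dot n eps).
Qed.

Let FS_base f z : FS f -> f (cube0 d, z) = z.
Proof.
move=> FSf; suff : closure [set z] (f (cube0 d, z)).
  have /closure_id <- // : closed [set z].
  by apply: compact_closed => //; exact: compact_set1.
move: f FSf; apply: closure_cont; first exact: eval_cont.
by move=> _ [n _ <-]; apply: subset_closure; rewrite /face_action/= cube_dot0r.
Qed.

(* For s = enum 'I_d this is the identity at the vertex 0 and u elsewhere. *)
Let along (s : seq 'I_d) (u : env) : cenv :=
  fun p => if has p.1 s then u p.2 else p.2.

(* Each single direction acts by u through a limit of face transformations; a
   vertex lying on several of these faces sees a power of u, which is u. *)
Let FS_along s u : ES u -> eop u u = u -> FS (along s u).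
Proof.
move=> ESu uu; elim: s => [|i s IH].
  have -> : along [::] u = face_action (fun=> 0); last exact: FS_face.
  by apply/funext => p; rewrite /face_action cube_dot0l.
have -> : along (i :: s) u = cop (along [:: i] u) (along s u).
  apply/funext => -[eps z]; rewrite /cop /along /= orbF.
  case: (eps i); case: (has _ _) => //=.
  by move/(congr1 (@^~ z)): uu.
apply: FSS => //; move: u ESu {uu IH}.
apply: (@closure_cont env cenv (along [:: i])).
  apply: ptws_continuous => -[eps z]; rewrite /along /= orbF.
  case: (eps i); first exact: eval_cont.
  exact: cst_continuous.
move=> _ [n _ <-].
have -> : along [:: i] (iterz T n) = face_action (fun j => if j == i then n else 0).
  apply/funext => -[eps z]; rewrite /along /face_action /= orbF cube_dot_single.
  by case: (eps i).
exact: FS_face.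
Qed.

Let cube_has (eps : cube d) : has eps (enum 'I_d) = (eps != cube0 d).
Proof.
apply/hasP/idP => [[i _ epsi]|].
  by apply: contraL epsi => /eqP ->; rewrite ffunE.
apply: contra_neqP => nh; apply/ffunP => i; rewrite ffunE.
by apply/negP => ei; apply: nh; exists i; rewrite ?mem_enum.
Qed.

Variable y : Z.
Hypothesis y_min : minimal_point T y.

Let eval_ES f : ES f -> closure (orbitz T y) (f y).
Proof.
move: f; apply: (@closure_cont env Z (fun f => f y)); first exact: eval_cont.
by move=> _ [n _ <-]; apply: subset_closure; exists n.
Qed.

Let ES_onto f : ES f -> forall z, closure (orbitz T y) z ->
  exists2 g, ES g & g (f y) = z.
Proof.
move=> ESf z yz.
have cimg : compact ((fun g : env => g (f y)) @` ES).
  apply: continuous_compact => //; apply: continuous_subspaceT.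
  exact: eval_cont.
have : closure (orbitz T (f y)) z by apply: y_min => //; exact: eval_ES.
move=> /(closureS (B := (fun g : env => g (f y)) @` ES)).
rewrite -(closure_id _).1; last exact: compact_closed.
case=> [_ [n _ <-]|g ESg <-]; last by exists g.
by exists (iterz T n).
Qed.

(** Minimality of y makes L y the whole orbit closure of y; hence the elements
    of L that fix y form a nonempty compact semigroup. *)
Lemma minimal_idempotent_fixing : exists L u,
  [/\ minimal_left_ideal eop ES L, L u, eop u u = u & u y = y].
Proof.
have ES0 : ES !=set0 by exists (iterz T 0); exact: ES_iterz.
have idES : left_ideal eop ES ES by split => // s l; exact: ESS.
have [L _ minL] := minimal_left_ideal_exists (@ptws_hausdorff _) eopA eop_cont
  ES0 cES ESS idES.
have [[L0 cL LE LL] _] := minL.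
have [|||f [Lf fy] ff] := @idempotent_exists env eop (@ptws_hausdorff _) eopA
  eop_cont (L `&` [set f | f y = y]).
- have yy : closure (orbitz T y) y by apply: subset_closure; exists 0.
  have [f Lf] := L0; have [g ESg gfy] := ES_onto (LE _ Lf) yy.
  by exists (eop g f); split => //; exact: LL.
- apply: compact_closedI => //.
  apply: (@closed_comp _ _ (fun f : env => f y) [set y]) => [? _|].
    exact: eval_cont.
  by apply: compact_closed => //; exact: compact_set1.
- by move=> f g [Lf fy] [Lg gy]; split; [exact: LL (LE _ Lf) Lg|rewrite /= /eop gy].
by exists L, f.
Qed.

(** Let ut be the identity at the vertex 0 and u elsewhere.  An idempotent eta of
    a minimal left ideal inside FS ut has, away from 0, coordinates that are
    idempotents in the ideal of u; they satisfy u eta = u, so that ut eta = ut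
    lies in this minimal left ideal.  Hence ut can be recovered from f ut by
    multiplication on the left, and ut fixes the constant cube y. *)
Lemma face_returns (f : cenv) : FS f ->
  exists2 g, FS g & forall eps, g (eps, f (eps, y)) = y.
Proof.
move=> FSf.
have [L [u [minL Lu uu uy]]] := minimal_idempotent_fixing.
have [[L0 cL LE LL] _] := minL.
pose ut := along (enum 'I_d) u.
have FSut : FS ut by apply: FS_along => //; exact: LE.
have FS0 : FS !=set0 by exists ut.
have idJ := left_ideal_principal copA cop_cont FS0 cFS FSS FSut.
have [K KJ minK] := minimal_left_ideal_exists (@ptws_hausdorff _) copA cop_cont
  FS0 cFS FSS idJ.
have [[K0 cK KF KK] minK'] := minK.
have [eta Keta ee] := idempotent_exists (@ptws_hausdorff _) copA cop_cont K0 cK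
  (fun f g Kf Kg => KK _ _ (KF _ Kf) Kg).
have [s FSs seta] := KJ _ Keta.
(* FS acts trivially at the vertex 0, and eta_v lies in L elsewhere. *)
have ueta : cop ut eta = ut.
  apply/funext => -[eps z]; rewrite /cop /ut /along /= cube_has.
  case: ifPn => [eps0|/negPn/eqP ->]; last by apply: FS_base; exact: KF.
  have Le : L (fun z => eta (eps, z)).
    rewrite -seta; have := LL _ _ (@FS_coord eps _ FSs) Lu.
    congr L; apply/funext => x.
    by rewrite /eop /cop /ut /along /= cube_has eps0.
  have ide : eop (fun z => eta (eps, z)) (fun z => eta (eps, z)) =
      (fun z => eta (eps, z)).
    by apply/funext => x; move/(congr1 (@^~ (eps, x))): ee.
  by have /(congr1 (@^~ z)) := minimal_left_ideal_idem eopA minL Lu Le ide.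
have Kut : K ut by rewrite -ueta; exact: KK.
have [g FSg gf] := minK' _ (KK _ _ FSf Kut) _ Kut.
exists g => // eps; have /(congr1 (@^~ (eps, y))) := gf.
by rewrite /cop /ut /along /= cube_has; case: ifP; rewrite ?uy.
Qed.

(** By the previous lemma, each limit f of face transformations can be moved
    back near the constant cube y by some m in Z^d; the set of the f for which
    a given m works is a neighbourhood, and FS is compact. *)
Lemma minimal_point_cube_syndetic (B : set Z) : nbhs y B ->
  exists M : seq {ffun 'I_d -> int}, forall n : 'I_d -> int,
    exists2 m, m \in M & forall eps : cube d,
      B (iterz T (cube_dot (fun i => n i + m i) eps) y).
Proof.
move=> By.
have [|M MP] := @compact_finite_cover cenv {ffun 'I_d -> int} FS
    (fun m => [set f | forall eps, B (iterz T (cube_dot m eps) (f (eps, y)))])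
    cFS.
  move=> f FSf; have [g FSg gf] := face_returns FSf.
  have : \forall h \near g, forall eps, B° (h (eps, f (eps, y))).
    apply: nbhs_forall => eps; apply: (@eval_cont _ (eps, f (eps, y)) g).
    by rewrite gf; exact: nbhs_interior.
  move=> /FSg[_ [[m _ <-] gB]]; exists [ffun i => m i].
  apply: nbhs_forall => eps.
  suff : \forall h \near f, B° (iterz T (cube_dot m eps) (h (eps, y))).
    apply: filterS => h /interior_subset; congr (B (iterz T _ _)).
    by apply: eq_bigr => i _; rewrite ffunE.
  apply: (@continuous_comp cenv _ _ (fun h => h (eps, y))
    (iterz T (cube_dot m eps)) f).
  - exact: eval_cont.
  - exact: iterz_continuous.
  - by apply: open_nbhs_nbhs; split; [exact: open_interior|exact: gB].
exists M => n; have [m mM mn] := MP _ (@FS_face n).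
exists m => // eps; rewrite cube_dotD addrC iterzD; exact: mn.
Qed.
End CubeEnvelopingSemigroup.

(** * Baire category and minimal sets *)

Lemma shrink_nbhs (Z : uniformType) (x : Z) (U : set Z) : nbhs x U ->
  exists V, [/\ open V, V x & closure V `<=` U].
Proof.
move=> /uniform_regular[V xV VU]; exists V°; split.
- exact: open_interior.
- by have := nbhs_singleton (nbhs_interior xV).
- by apply: subset_trans VU; apply: closureS; exact: interior_subset.
Qed.

(** Baire's theorem relative to a compact set A, in the form of a game: if every
    open set meeting A can be shrunk to one with the n-th property, then some
    point of A has, for every n, a neighbourhood with the n-th property. *)
Lemma baire_selection (Z : uniformType) (A : set Z) (P : nat -> set Z -> Prop)
    (U : set Z) :
  hausdorff_space Z -> compact A -> open U -> A `&` U !=set0 ->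
  (forall n V, open V -> V `<=` U -> A `&` V !=set0 ->
    exists W, [/\ open W, W `<=` V, A `&` W !=set0 & P n W]) ->
  exists z, [/\ A z, U z & forall n, exists W, [/\ open W, W z & P n W]].
Proof.
move=> hZ cA oU AU dense.
pose good V := [/\ open V, V `<=` U & A `&` V !=set0].
have step (p : nat * set Z) : exists V', good p.2 ->
    good V' /\ exists W, [/\ open W, closure V' `<=` W, W `<=` p.2 & P p.1 W].
  have [[oV VU AV]|ng] := pselect (good p.2); last by exists set0 => /ng.
  have [W [oW WV [z [Az Wz]] PW]] := dense p.1 p.2 oV VU AV.
  have [V' [oV' V'z V'W]] := shrink_nbhs (open_nbhs_nbhs (conj oW Wz)).
  exists V' => _; split; last by exists W.
  split => //; last by exists z.
  by move=> y V'y; apply: VU; apply: WV; apply: V'W; exact: subset_closure.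
have [g gP] := choice step.
pose V := fix V n := if n is m.+1 then g (m, V m) else U.
have Vgood n : good (V n) 
  by elim: n => [|n IH]; [split|have [] := gP (n, V n) IH].
have Vdec n m : (n <= m)%N -> V m `<=` V n.
  move=> /subnK <-; elim: (m - n)%N => [|k IH] //; rewrite addSn.
  have [_ [W [_ cW WV _]]] := gP ((k + n)%N, V (k + n)%N) (Vgood (k + n)%N).
  by move=> y Vy; apply: IH; apply: WV; apply: cW; exact: subset_closure.
have [||||[z zI] _] :=
    @compact_chain_nonempty _ [set A `&` closure (V n) | n in [set: nat]].
- exact: hZ.
- by exists (A `&` closure (V 0%N)), 0%N.
- move=> _ _ [n _ <-] [m _ <-].
  by have [nm|/ltnW mn] := leqP n m; [right|left]; apply: setIS;
    apply: closureS; exact: Vdec.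
- move=> _ [n _ <-]; have [_ _ [z [Az Vz]]] := Vgood n; split.
    by exists z; split => //; exact: subset_closure.
  by apply: compact_closedI => //; exact: closed_closure.
have zV n : closure (V n) z.
  by have [] : (A `&` closure (V n)) z by apply: zI; exists n.
have zW n : exists W, [/\ open W, W z, W `<=` V n & P n W].
  have [_ [W [oW cW WV PW]]] := gP (n, V n) (Vgood n).
  by exists W; split => //; exact: (cW _ (zV n.+1)).
exists z; split.
- by have [] : (A `&` closure (V 0%N)) z by apply: zI; exists 0%N.
- by have [W [_ Wz WU _]] := zW 0%N; exact: WU.
- by move=> n; have [W [oW Wz _ PW]] := zW n; exists W.
Qed.

(** Remove the first closed set from U: either nothing is left, or the rest is a
    smaller open set covered by the remaining sets. *)
Lemma finite_closed_cover_interior (Y : topologicalType) (I : eqType)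
    (s : seq I) (C : I -> set Y) (U : set Y) :
  (forall i, closed (C i)) -> open U -> U !=set0 ->
  (forall y, U y -> exists2 i, i \in s & C i y) ->
  exists i V, [/\ i \in s, open V, V !=set0 & V `<=` C i].
Proof.
move=> clC; elim: s U => [|i s IH] U oU [y Uy] cov; first by have [] := cov _ Uy.
have [UC|] := pselect (U `<=` C i).
  by exists i, U; split => //; [rewrite mem_head|exists y].
move=> /existsNP[x /not_implyP[Ux nCx]].
have [||z [Uz nCz]|j [V [js oV V0 VC]]] := IH (U `&` ~` C i).
- by apply: openI => //; exact: closed_openC.
- by exists x.
- have [j] := cov _ Uz; rewrite inE => /orP[/eqP -> //|js Cz].
  by exists j.
by exists j, V; split => //; rewrite inE js orbT.
Qed.

Section MinimalSets.
Variables (Z : topologicalType) (S : homeo Z) (A : set Z).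
Hypotheses (Amin : minimal_on S A)
  (Ainv : forall n z, A z -> A (iterz S n z)).

Lemma minimal_set_visits (z w : Z) (U : set Z) : A z -> A w -> nbhs w U ->
  exists n, U (iterz S n z).
Proof.
by move=> Az Aw Uw; have [_ [[n _ <-] Un]] := Amin Az Aw Uw; exists n.
Qed.

Lemma minimal_set_syndetic (U : set Z) : compact A -> open U ->
  A `&` U !=set0 ->
  exists K : seq int, forall z, A z -> exists2 k, k \in K & U (iterz S k z).
Proof.
move=> cA oU [w [Aw Uw]].
apply: (@compact_finite_cover _ _ A (fun k => [set z | U (iterz S k z)]) cA).
move=> z Az; have [|k Uk] := @minimal_set_visits z w U Az Aw.
  exact: open_nbhs_nbhs.
by exists k; apply: (iterz_continuous (x := z)); exact: open_nbhs_nbhs.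
Qed.

Lemma minimal_set_point (z : Z) : closed A -> A z -> minimal_point S z.
Proof.
move=> clA Az y zy w zw.
have sub : closure (orbitz S z) `<=` A.
  rewrite [X in _ `<=` X](closure_id A).1 //; apply: closureS => _ [n _ <-].
  exact: Ainv.
by apply: Amin; exact: sub.
Qed.

End MinimalSets.

(** * Points of locally uniform cube recurrence *)

Section GoodPoints.
Variables (R : realType) (Z : pseudoMetricType R) (S : homeo Z) (A : set Z).
Hypotheses (hZ : hausdorff_space Z) (cZ : compact [set: Z]) (clA : closed A).
Hypotheses (Amin : minimal_on S A) (Ainv : forall n z, A z -> A (iterz S n z)).

Let cA : compact A.
Proof. exact: (subclosed_compact clA cZ (@subsetT _ _)). Qed.

Section Factor.
Variables (Y : topologicalType) (T : homeo Y) (phi : Z -> Y).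
Hypotheses (hY : hausdorff_space Y) (phi_cont : continuous phi).
Hypothesis phi_iterz : forall n z, phi (iterz S n z) = iterz T n (phi z).
Hypothesis phi_onto : forall y, exists2 z, A z & phi z = y.

(** Finitely many translates of a closed piece of U cover A; their images cover
    the factor, so one of them has interior points. *)
Lemma factor_semi_open (U : set Z) : open U -> A `&` U !=set0 ->
  exists O, [/\ open O, O !=set0 & O `<=` phi @` (A `&` U)].
Proof.
move=> oU [c [Ac Uc]].
have [V [oV Vc VU]] := shrink_nbhs (open_nbhs_nbhs (conj oU Uc)).
have [|K KP] := minimal_set_syndetic Amin cA oV; first by exists c.
pose C k := [set y | (phi @` (A `&` closure V)) (iterz T k y)].
have [|||i [G [_ oG [y Gy] GC]]] :=
    @finite_closed_cover_interior Y _ K C setT _ openT.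
- move=> k; have /continuous_closedP := @iterz_continuous _ T k; apply.
  apply: compact_closed => //; apply: continuous_compact.
    by apply: continuous_subspaceT.
  by apply: compact_closedI => //; exact: closed_closure.
- by exists (phi c).
- move=> y _; have [z Az <-] := phi_onto y; have [k kK Vk] := KP z Az.
  exists k => //; exists (iterz S k z); last exact: phi_iterz.
  by split; [exact: Ainv|exact: subset_closure].
exists (iterz T (- i) @^-1` G); split.
- by apply: open_comp => // x _; exact: iterz_continuous.
- by exists (iterz T i y); rewrite /= -iterzD addNr.
- move=> x /GC[z [Az Vz] zx]; exists z; first by split => //; exact: VU.
  by rewrite zx -iterzD addrN.
Qed.

(** If z has, for every e, a neighbourhood V with this property, then the
    restriction of phi to A is open at z. *)
Definition fibre_open (e : R) (V : set Z) :=
  forall z, A z -> V z -> nbhs (phi z) (phi @` (A `&` ball z e)).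

Lemma fibre_open_dense (e : R) (U : set Z) : 0 < e -> open U ->
  A `&` U !=set0 ->
  exists V, [/\ open V, V `<=` U, A `&` V !=set0 & fibre_open e V].
Proof.
move=> e0 oU [c [Ac Uc]].
pose U' := U `&` (ball c (e / 2))°.
have oU' : open U' by apply: openI => //; exact: open_interior.
have [|G [oG [y Gy] GU']] := factor_semi_open oU'.
  exists c; split => //; split => //; apply: nbhs_singleton.
  by apply: nbhs_interior; apply: nbhsx_ballx; rewrite divr_gt0.
exists (U' `&` phi @^-1` G); split.
- by apply: openI => //; apply: open_comp => // x _; exact: phi_cont.
- by move=> z [[]].
- have [z [Az U'z] zy] := GU' _ Gy.
  by exists z; split => //; split => //=; rewrite zy.
- move=> z Az [[_ /interior_subset cz] Gz].
  apply: (@filterS _ _ _ G); last exact: open_nbhs_nbhs.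
  move=> x /GU'[z' [Az' [_ /interior_subset cz']] <-]; exists z' => //.
  by split => //; exact: (ball_splitr cz cz').
Qed.
End Factor.

(** Uniformity in the base point z' is what distinguishes this from the
    recurrence of a single constant cube. *)
Definition cube_tight (d : nat) (e : R) (V : set Z) :=
  exists M : seq {ffun 'I_d -> int}, forall z z', A z -> V z -> A z' -> V z' ->
    forall n : 'I_d -> int, exists2 m, m \in M & forall eps : cube d,
      ball z e (iterz S (cube_dot (fun i => n i + m i) eps) z').

(** Every point of A returns with some finite set M of corrections.  There are
    countably many M, and the points for which M works form a closed set, so one
    of these sets has an interior point. *)
Lemma cube_tight_dense (d : nat) (e : R) (U : set Z) : 0 < e -> open U ->
  A `&` U !=set0 ->
  exists V, [/\ open V, V `<=` U, A `&` V !=set0 & cube_tight d e V].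
Proof.
move=> e0 oU [c [Ac Uc]].
have /shrink_nbhs[K [oK Kc cKU]] : nbhs c (U `&` ball c (e / 2)).
  apply: filterI; first exact: open_nbhs_nbhs.
  by apply: nbhsx_ballx; rewrite divr_gt0.
pose good (M : seq {ffun 'I_d -> int}) := [set z |
  forall n : 'I_d -> int, exists2 m, m \in M & forall eps : cube d,
    closure K (iterz S (cube_dot (fun i => n i + m i) eps) z)].
have cl_good M : closed (good M).
  have -> : good M = \bigcap_(n in [set: 'I_d -> int])
      \bigcup_(m in [set` M]) \bigcap_(eps in [set: cube d])
      (iterz S (cube_dot (fun i => n i + m i) eps) @^-1` closure K).
    apply/seteqP; split => z gz n.
      by move=> _; have [m mM mz] := gz n; exists m => // eps _; exact: mz.
    by have [m mM mz] := gz n I; exists m => // eps; exact: (mz eps I).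
  apply: closed_bigI => n _; apply: closed_bigcup; first exact: finite_seq.
  move=> m _; apply: closed_bigI => eps _.
  have /continuous_closedP :=
    @iterz_continuous _ S (cube_dot (fun i => n i + m i) eps).
  by apply; exact: closed_closure.
pose Mn k : seq {ffun 'I_d -> int} := odflt [::] (unpickle k).
apply: contrapT => noV.
have [||z [Az Kz zP]] := @baire_selection Z A
  (fun k V => A `&` V `<=` ~` good (Mn k)) K hZ cA oK.
- by exists c.
- move=> k V oV VK [w [Aw Vw]].
  have [sub|] := pselect (A `&` V `<=` good (Mn k)).
    case: noV; exists V; split => //.
    + by move=> z /VK/subset_closure/cKU[].
    + by exists w.
    + exists (Mn k) => z z' _ Vz Az' Vz' n.
      have [m mM mz'] := sub _ (conj Az' Vz') n; exists m => // eps.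
      apply: (@ball_splitr _ _ c).
        by have /VK/subset_closure/cKU[] := Vz.
      by have /cKU[] := mz' eps.
  move=> /existsNP[z /not_implyP[[Az Vz] ngz]].
  exists (V `&` ~` good (Mn k)); split.
  + by apply: openI => //; exact: closed_openC.
  + by move=> ? [].
  + by exists z.
  + by move=> ? [_ []].
have [M MP] := minimal_point_cube_syndetic d cZ hZ
  (minimal_set_point Amin Ainv clA Az) (open_nbhs_nbhs (conj oK Kz)).
have [W [_ Wz WP]] := zP (pickle M).
apply: (WP z) => // n; rewrite /Mn pickleK /=.
by have [m mM mK] := MP n; exists m => // eps; exact: subset_closure.
Qed.

Lemma good_point_exists (Y : topologicalType) (T : homeo Y) (phi : Z -> Y)
    (d : nat) (U : set Z) :
  hausdorff_space Y -> continuous phi ->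
  (forall n z, phi (iterz S n z) = iterz T n (phi z)) ->
  (forall y, exists2 z, A z & phi z = y) ->
  open U -> A `&` U !=set0 ->
  exists b, [/\ A b, U b,
    forall e : R, 0 < e -> exists (M : seq {ffun 'I_d -> int}) P, nbhs b P /\
      forall z, A z -> P z -> forall n : 'I_d -> int,
      exists2 m, m \in M & forall eps : cube d,
        ball b e (iterz S (cube_dot (fun i => n i + m i) eps) z) &
    forall P, nbhs b P -> nbhs (phi b) (phi @` (A `&` P))].
Proof.
move=> hY phi_cont phi_iterz phi_onto oU AU.
pose e_ (k : nat) : R := k.+1%:R^-1.
have e_gt0 k : 0 < e_ k by rewrite invr_gt0.
have small e : 0 < e -> exists k, e_ k <= e.
  by move=> /ltr_add_invr[k /ltW]; rewrite add0r; exists k.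
have [|b [Ab Ub bP]] := @baire_selection Z A
  (fun k V => cube_tight d (e_ k) V /\ fibre_open phi (e_ k) V) U hZ cA oU AU.
  move=> k V oV VU AV.
  have [W [oW WV AW tW]] := cube_tight_dense d (e_gt0 k) oV AV.
  have [W' [oW' WW' AW' fW']] :=
    fibre_open_dense hY phi_cont phi_iterz phi_onto (e_gt0 k) oW AW.
  exists W'; split => //; first exact: subset_trans WV.
  split => //; have [M MP] := tW; exists M => z z' Az /WW' Wz Az' /WW' Wz'.
  exact: MP.
exists b; split => //.
  move=> e /small[k ke]; have [W [oW Wb [[M MP] _]]] := bP k.
  exists M, W; split; first exact: open_nbhs_nbhs.
  move=> z Az Wz n; have [m mM mz] := MP b z Ab Wb Az Wz n.
  by exists m => // eps; exact: le_ball (mz eps).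
move=> P /nbhs_ballP[e /= /small[k ke] eP]; have [W [oW Wb [_ fW]]] := bP k.
apply: filterS (fW _ Ab Wb) => _ [z [Az bz] <-]; exists z => //; split => //.
by apply: eP; exact: le_ball bz.
Qed.

End GoodPoints.

(** * Factors and equicontinuity *)

Lemma factor_onto (Z Y : topologicalType) (S : homeo Z) (T : homeo Y)
    (phi : Z -> Y) (A : set Z) :
  hausdorff_space Y -> compact A -> A !=set0 ->
  (forall n z, A z -> A (iterz S n z)) -> continuous phi ->
  (forall n z, phi (iterz S n z) = iterz T n (phi z)) -> minimal_system T ->
  forall y, exists2 z, A z & phi z = y.
Proof.
move=> hY cA [a Aa] Ainv phi_cont phi_iterz Tmin y.
have cl : closed (phi @` A).
  apply: compact_closed => //; apply: continuous_compact => //.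
  by apply: continuous_subspaceT.
suff : (phi @` A) y by [].
rewrite (closure_id (phi @` A)).1 //.
have : closure (orbitz T (phi a)) y by exact: Tmin.
apply: closureS => _ [n _ <-]; exists (iterz S n a); first exact: Ainv.
exact: phi_iterz.
Qed.

Lemma compact_unif_continuous (R : realType) (X Y : pseudoMetricType R)
    (f : X -> Y) (e : R) : compact [set: X] -> continuous f -> 0 < e ->
  \forall r \near 0^'+, forall x y, ball x r y -> ball (f x) e (f y).
Proof.
move=> /compact_near_coveringP cX cf e0.
pose P (r : R) x := forall y, ball x r y -> ball (f x) e (f y).
have : \forall r \near 0^'+, [set: X] `<=` P r.
  apply: cX => x _.
  have /nbhs_ballP[r /= r0 rP] : nbhs x (f @^-1` ball (f x) (e / 2)).
    by apply: cf; apply: nbhsx_ballx; rewrite divr_gt0.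
  exists (ball x (r / 2), [set s | s < r / 2]) => /=.
    split; first by apply: nbhsx_ballx; rewrite divr_gt0.
    by apply: nbhs_right_lt; rewrite divr_gt0.
  move=> [x' s] /= [xx' sr] y x'y; apply: (@ball_splitr _ _ (f x)).
    apply: rP; apply: le_ball xx'.
    by rewrite ler_pdivrMr // ler_pMr // ler1n.
  by apply: rP; apply: (ball_split xx'); exact: (le_ball (ltW sr)) x'y.
by apply: filterS => r rP x y; exact: rP.
Qed.

Lemma iterz_equicontinuous (R : realType) (X : pseudoMetricType R)
    (T : homeo X) (s : seq int) (e : R) : compact [set: X] -> 0 < e ->
  exists2 r, 0 < r & forall k x y, k \in s -> ball x r y ->
    ball (iterz T k x) e (iterz T k y).
Proof.
move=> cX e0.
have : \forall r \near 0^'+, forall k x y, k \in s -> ball x r y ->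
    ball (iterz T k x) e (iterz T k y).
  elim: s => [|k s IH]; first by apply: nearW => r.
  have := compact_unif_continuous cX (@iterz_continuous _ T k) e0.
  apply: filterS2 IH => r IH kP k' x y; rewrite inE => /orP[/eqP ->|k's].
    exact: kP.
  exact: IH.
move=> near0.
have : \forall r \near (0 : R)^'+, 0 < r by exact: nbhs_right_gt.
by move=> /(filterI near0)/filter_ex[r [rP r0]]; exists r.
Qed.

(** * Cubes of dimension d+1 *)

Section CubeVertices.
Variable d : nat.

Definition cube_cons (b : bool) (v : cube d) : cube d.+1 :=
  [ffun j => if unlift ord0 j is Some j' then v j' else b].

Definition cube_tail (v : cube d.+1) : cube d := [ffun j => v (lift ord0 j)].

Definition vec_cons (a : int) (n : 'I_d -> int) : 'I_d.+1 -> int :=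
  fun j => if unlift ord0 j is Some j' then n j' else a.

Lemma cube_cons_tail (v : cube d.+1) : cube_cons (v ord0) (cube_tail v) = v.
Proof.
by apply/ffunP => j; rewrite ffunE; case: unliftP => [j'|] ->; rewrite ?ffunE.
Qed.

Lemma cube_dotS (n : 'I_d.+1 -> int) (v : cube d.+1) :
  cube_dot n v =
  (if v ord0 then n ord0 else 0) +
  cube_dot (fun j => n (lift ord0 j)) (cube_tail v).
Proof.
rewrite /cube_dot big_ord_recl; congr (_ + _).
  by case: (v ord0); rewrite ?mulr1 ?mulr0.
by apply: eq_bigr => j _; rewrite ffunE.
Qed.

Lemma cube_dot_cons (n : 'I_d.+1 -> int) (b : bool) (v : cube d) :
  cube_dot n (cube_cons b v) =
  (if b then n ord0 else 0) + cube_dot (fun j => n (lift ord0 j)) v.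
Proof.
rewrite cube_dotS ffunE unlift_none; congr (_ + cube_dot _ _).
by apply/ffunP => j; rewrite !ffunE liftK.
Qed.

Lemma cube_dot_vec_cons (a : int) (n : 'I_d -> int) (b : bool) (v : cube d) :
  cube_dot (vec_cons a n) (cube_cons b v) = (if b then a else 0) + cube_dot n v.
Proof.
rewrite cube_dot_cons /vec_cons unlift_none; congr (_ + cube_dot _ _).
by apply/funext => j; rewrite liftK.
Qed.

Lemma cube_cons_neq0 (b : bool) (v : cube d) :
  (cube_cons b v != cube0 d.+1) = b || (v != cube0 d).
Proof.
apply/idP/orP => [|[b1|]].
- move=> vn; case: b vn => [|vn]; first by left.
  right; apply: contraNneq vn => ->; apply/eqP/ffunP => j; rewrite !ffunE.
  by case: unliftP => // j' _; rewrite ffunE.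
- apply/eqP => /ffunP/(_ ord0); rewrite !ffunE unlift_none.
  by move=> b0; rewrite b0 in b1.
- apply: contra => /eqP /ffunP v0; apply/eqP/ffunP => j.
  by have := v0 (lift ord0 j); rewrite !ffunE liftK.
Qed.

Section Rebase.
Variable i : 'I_d.+1.
Hypothesis i_neq0 : i != ord0.

(** A vertex v of the face v_i = 1 seen from the corner with coordinates 0 and i
    equal to 1: the direction 0 is reversed and the direction i is constant. *)
Definition rebase (v : cube d.+1) : cube d.+1 :=
  [ffun j => if j == ord0 then ~~ v ord0 else if j == i then false else v j].

Let cube_dot_split (n : 'I_d.+1 -> int) (v : cube d.+1) :
  cube_dot n v = (if v ord0 then n ord0 else 0) +
    ((if v i then n i else 0) +
     \sum_(j | (j != ord0) && (j != i)) n j * (v j)%:Z).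
Proof.
rewrite /cube_dot (bigD1 ord0) //= (bigD1 i) //=.
by case: (v ord0); case: (v i); rewrite ?mulr1 ?mulr0.
Qed.

Let rest_rebase (n : 'I_d.+1 -> int) (v : cube d.+1) :
  \sum_(j | (j != ord0) && (j != i)) n j * (rebase v j)%:Z =
  \sum_(j | (j != ord0) && (j != i)) n j * (v j)%:Z.
Proof.
by apply: eq_bigr => j /andP[/negPf j0 /negPf ji]; rewrite ffunE j0 ji.
Qed.

(** The direction vector obtained from n when the face v_i = 1, seen from its
    corner, is moved by m in all its directions. *)
Definition rebase_dir (n m : 'I_d.+1 -> int) : 'I_d.+1 -> int :=
  fun j => if j == ord0 then n ord0 - m ord0
           else if j == i then n i else n j + m j.

(** Moving the reversed direction 0 displaces the base point of the whole cube
    by m ord0.  The motion of a vertex does not depend on its i-th coordinate, so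
    that opposite vertices in the direction i move together. *)
Lemma cube_dot_rebase_move (n m : 'I_d.+1 -> int) (v : cube d.+1) :
  cube_dot (rebase_dir n m) v + m ord0 =
  cube_dot m (rebase v) + cube_dot n v.
Proof.
rewrite !cube_dot_split rest_rebase !ffunE /rebase_dir eqxx (negPf i_neq0) eqxx.
rewrite [X in _ + (_ + X) + _]
  (eq_bigr (fun j => n j * (v j)%:Z + m j * (v j)%:Z)); last first.
  by move=> j /andP[/negPf -> /negPf ->]; rewrite mulrDl.
by rewrite big_split /=; case: (v ord0); case: (v i) => /=; ring.
Qed.

Lemma cube_dot_rebase (n : 'I_d.+1 -> int) (v : cube d.+1) : v i ->
  cube_dot n v =
  cube_dot (fun j => if j == ord0 then - n ord0 else n j) (rebase v) +
  (n ord0 + n i).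
Proof.
move=> vi.
rewrite !cube_dot_split rest_rebase !ffunE eqxx (negPf i_neq0) eqxx vi.
rewrite [X in _ = _ + (_ + X) + _](eq_bigr (fun j => n j * (v j)%:Z));
  last first.
  by move=> j /andP[/negPf -> _].
by case: (v ord0) => /=; ring.
Qed.

End Rebase.

End CubeVertices.

(** * The square system and the regionally proximal relation *)

Section SquareSystem.
Variables (R : realType) (X : metricType R) (T : homeo X).

Lemma iterz_square (n : int) (z : X * X) :
  iterz (homeo_square T) n z = (iterz T n z.1, iterz T n z.2).
Proof.
have it (f : X -> X) k : iter k (square_map f) z = (iter k f z.1, iter k f z.2).
  by elim: k => [|k IH]; [case: z | rewrite !iterS IH].
by case: n => n; exact: it.
Qed.

Lemma RP_ball (d : nat) (x y : X) (r : R) : RP T d x y -> 0 < r ->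
  exists x' y' (n : 'I_d -> int), [/\ ball x r x', ball y r y' &
    forall v : cube d, v != cube0 d ->
      ball (iterz T (cube_dot n v) x') r (iterz T (cube_dot n v) y')].
Proof.
move=> xyRP /xyRP[x' [y' [n [xx' yy' nP]]]].
by exists x', y', n; split => [||v v0]; rewrite ballEmdist //=; exact: nP.
Qed.

Lemma ball_RP (d : nat) (x y : X) :
  (forall r : R, 0 < r -> exists x' y' (n : 'I_d -> int),
    [/\ ball x r x', ball y r y' & forall v : cube d, v != cube0 d ->
      ball (iterz T (cube_dot n v) x') r (iterz T (cube_dot n v) y')]) ->
  RP T d x y.
Proof.
move=> xyRP r /xyRP[x' [y' [n []]]]; rewrite !ballEmdist /= => xx' yy' nP.
by exists x', y', n; split => // v /nP; rewrite ballEmdist.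
Qed.

Lemma RP_orbit_closure (d : nat) (x y : X) (c : X * X) :
  compact [set: X] -> RP T d x y ->
  closure (orbitz (homeo_square T) (x, y)) c -> RP T d c.1 c.2.
Proof.
move=> cX xyRP cc; apply: ball_RP => r r0.
have r20 : 0 < r / 2 by rewrite divr_gt0.
have [_ [[i _ <-]]] := cc _ (nbhsx_ballx c _ r20).
rewrite iterz_square => -[/= ci1 ci2].
have [s s0 sP] := iterz_equicontinuous T [:: i] cX r20.
have {}sP u v : ball u s v -> ball (iterz T i u) (r / 2) (iterz T i v).
  by apply: sP; rewrite inE.
have [x' [y' [n [xx' yy' nP]]]] := RP_ball xyRP s0.
exists (iterz T i x'), (iterz T i y'), n; split.
- exact: (ball_split ci1 (sP _ _ xx')).
- exact: (ball_split ci2 (sP _ _ yy')).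
- move=> v v0; rewrite -!iterzD ![_ + i]addrC !iterzD.
  apply: le_ball (sP _ _ (nP v v0)).
  by rewrite ler_pdivrMr // ler_pMr // ler1n.
Qed.

End SquareSystem.

(** If p and q are both close to c and f brings p back to c, then f brings c, and
    therefore q, back to c as well. *)
Lemma ball_transfer (R : realType) (Y : pseudoMetricType R) (f : Y -> Y)
    (e r : R) (c p q : Y) : 0 < e ->
  (forall x y, ball x r y -> ball (f x) (e / 2 / 2) (f y)) ->
  ball c r p -> ball c r q -> ball c (e / 2 / 2) (f p) -> ball c e (f q).
Proof.
move=> e0 fP cp cq cfp; apply: (@ball_split _ _ (f c)).
  by apply: (ball_split cfp); apply: ball_sym; exact: fP.
apply: le_ball (fP _ _ cq); rewrite ler_pdivrMr // ler_pMr ?ler1n //.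
by rewrite divr_gt0.
Qed.

(** * Collapsing cubes onto a good point *)

Section CollapsingCubes.
Variables (R : realType) (X : metricType R) (T : homeo X) (d : nat).
Notation S := (homeo_square T).
Variable A : set (X * X).
Hypotheses (cX : compact [set: X]) (Tmin : minimal_system T).
Hypotheses (clA : closed A) (Amin : minimal_on S A).
Hypothesis Ainv : forall n z, A z -> A (iterz S n z).
Hypothesis A_RP : forall c, A c -> RP T d c.1 c.2.

Variable b : X * X.
Hypothesis Ab : A b.
Hypothesis b_tight : forall e : R, 0 < e ->
  exists (M : seq {ffun 'I_d.+1 -> int}) P, nbhs b P /\
    forall z, A z -> P z -> forall n : 'I_d.+1 -> int,
    exists2 m, m \in M & forall v : cube d.+1,
      ball b e (iterz S (cube_dot (fun i => n i + m i) v) z).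
Hypothesis b_open : forall P, nbhs b P -> nbhs b.1 (fst @` (A `&` P)).

Let hX : hausdorff_space X := @metric_hausdorff _ X.

Let cZ : compact [set: X * X].
Proof. by rewrite -setXTT; exact: compact_setX. Qed.

Let cA : compact A.
Proof. exact: (subclosed_compact clA cZ (@subsetT _ _)). Qed.

Let fst_cont : continuous (@fst X X). Proof. by move=> z; exact: cvg_fst. Qed.
Let snd_cont : continuous (@snd X X). Proof. by move=> z; exact: cvg_snd. Qed.

Let fst_iterz n z : (iterz S n z).1 = iterz T n z.1.
Proof. by rewrite iterz_square. Qed.

Let snd_iterz n z : (iterz S n z).2 = iterz T n z.2.
Proof. by rewrite iterz_square. Qed.

Let A0 : A !=set0. Proof. by exists b. Qed.

Let fst_onto := factor_onto hX cA A0 Ainv fst_cont fst_iterz Tmin.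
Let snd_onto := factor_onto hX cA A0 Ainv snd_cont snd_iterz Tmin.

(** The base point is tied to b.1 by its second coordinate and not, as the other
    vertices are, by the first one: for a cube that is otherwise close to b this
    relates the two coordinates of a point of A by an RP-like condition in A. *)
Definition collapsed (k : nat) := forall e : R, 0 < e ->
  exists (z : X * X) (n : 'I_d.+1 -> int), [/\ A z, ball b.1 e z.2,
    forall v, v != cube0 d.+1 -> ball b.1 e (iterz S (cube_dot n v) z).1 &
    forall v : cube d.+1, (exists2 j : 'I_d.+1, (j < k)%N & v j) ->
      ball b e (iterz S (cube_dot n v) z)].

(** Choose a in A with a.2 = b.1.  As the projection of A is semi-open near a,
    there is a point c = S^j a still close to a such that all points near c.1
    lift to points of A near a.  A cube witnessing that c is an RP^[d]-pair has
    two halves, starting at x' near c.1 and y' near c.2, hence near b.1.  Lift x'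
    to w near a, and y' to z' near b; recurrence at b moves the half of z'
    near b, and therefore the half of x' over b.1.  Finally the orbit of w comes
    close to z', which makes both halves parts of one cube based at w. *)
Lemma collapsed1 : collapsed 1.
Proof.
move=> e e0.
have e20 : 0 < e / 2 by rewrite divr_gt0.
have e40 : 0 < e / 2 / 2 by rewrite divr_gt0.
have [M [P [bP MP]]] := b_tight e40.
have /nbhs_ballP[r /= r0 rN] := b_open bP.
have [dl dl0 dlP] := iterz_equicontinuous T
  [seq cube_dot m v | m : {ffun 'I_d.+1 -> int} <- M, v <- enum (cube d.+1)]
  cX e40.
have {}dlP m v x y : m \in M -> ball x dl y ->
    ball (iterz T (cube_dot m v) x) (e / 2 / 2) (iterz T (cube_dot m v) y).
  by move=> mM; apply: dlP; apply/allpairsP; exists (m, v); rewrite mem_enum.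
have [a Aa ab] := snd_onto b.1.
pose r' := Num.min (r / 2) e.
have r'0 : 0 < r' by rewrite lt_min divr_gt0.
have aU : (ball a r')° a.
  by have := nbhs_singleton (nbhs_interior (nbhsx_ballx a _ r'0)).
have [|G [oG [y Gy] GU]] := factor_semi_open cZ clA Amin Ainv hX fst_cont
    fst_iterz fst_onto (open_interior (ball a r')).
  by exists a.
have [z0 [Az0 Uz0] z0y] := GU _ Gy.
have [|j [Uj Gj]] := @minimal_set_visits _ S A Amin a z0
    ((ball a r')° `&` fst @^-1` G) Aa Az0.
  apply: filterI.
    by apply: open_nbhs_nbhs; split => //; exact: open_interior.
  by apply: fst_cont; rewrite z0y; exact: open_nbhs_nbhs.
set c := iterz S j a in Uj Gj.
have Ac : A c by exact: Ainv.
have /nbhs_ballP[s /= s0 sG] : nbhs c.1 G by exact: open_nbhs_nbhs.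
pose t := Num.min dl (Num.min s r').
have t0 : 0 < t by rewrite !lt_min dl0 s0 e0 divr_gt0.
have tdl : t <= dl by rewrite ge_min lexx.
have tsr : t <= Num.min s r' by rewrite ge_min lexx orbT.
have ts : t <= s by apply: le_trans tsr _; rewrite ge_min lexx.
have tr : t <= r' by apply: le_trans tsr _; rewrite ge_min lexx orbT.
have [x' [y' [n [cx' cy' nP]]]] := RP_ball (A_RP Ac) t0.
have [w [Aw Uw] wx'] : (fst @` (A `&` (ball a r')°)) x'.
  by apply: GU; apply: sG; exact: le_ball cx'.
have [z' [Az' Pz'] zy'] : (fst @` (A `&` P)) y'.
  apply: rN; rewrite -ab; apply: (@ball_split _ _ c.2).
    have /interior_subset[_ +] := Uj; apply: le_ball.
    by rewrite /r' ge_min lexx.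
  by apply: le_ball cy'; rewrite (le_trans tr) // /r' ge_min lexx.
have [m mM mP] := MP _ Az' Pz' (vec_cons 0 n).
pose N := fun i => vec_cons 0 n i + m i.
have [|k kP] := @minimal_set_visits _ S A Amin w z'
    [set u | forall v, ball b (e / 2) (iterz S (cube_dot N v) u)] Aw Az'.
  apply: nbhs_forall => v.
  apply: (@iterz_continuous _ S (cube_dot N v) z').
  apply/nbhs_ballP; exists (e / 2 / 2) => //= u; exact: (ball_split (mP v)).
pose kN i := if i == ord0 then k else N i.
exists w, kN.
have dotE v : cube_dot kN v =
    cube_dot N (cube_cons false (cube_tail v)) + (if v ord0 then k else 0).
  by rewrite cube_dotS cube_dot_cons add0r addrC.
have face (v : cube d.+1) : v ord0 -> ball b e (iterz S (cube_dot kN v) w).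
  move=> v0; rewrite dotE v0 iterzD; apply: le_ball (kP _).
  by rewrite ler_pdivrMr // ler_pMr // ler1n.
split => //.
- have /interior_subset[_ +] := Uw; rewrite ab; apply: le_ball.
  by rewrite /r' ge_min lexx orbT.
- move=> v; rewrite -{1}[v]cube_cons_tail cube_cons_neq0.
  have [v0 _|v0 /= vt] := boolP (v ord0); first by have [] := face v v0.
  rewrite dotE (negPf v0) addr0 fst_iterz wx'.
  apply: le_ball (_ : ball b.1 (e / 2) _).
    by rewrite ler_pdivrMr // ler_pMr // ler1n.
  apply: ball_split.
    have [+ _] := mP (cube_cons false (cube_tail v)); exact.
  have NE u : iterz T (cube_dot N (cube_cons false (cube_tail v))) u =
      iterz T (cube_dot m (cube_cons false (cube_tail v)))
        (iterz T (cube_dot n (cube_tail v)) u).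
    by rewrite -iterzD /N cube_dotD addrC cube_dot_vec_cons add0r.
  rewrite fst_iterz zy' -/N !NE; apply: dlP => //.
  by apply: ball_sym; apply: (le_ball tdl); exact: nP.
- move=> v [i]; rewrite ltnS leqn0 => /eqP i0 vi; apply: face.
  by rewrite (_ : ord0 = i) //; apply/val_inj.
Qed.

(** The corner of the face v_i = 1 with v_0 = 1 is already close to b, so
    recurrence at b moves the whole face near b.  A vertex off this face moves
    like its neighbour on the face: where both were close to the same point (b, or
    b.1 in the first coordinate), this point returns to itself, and so does the
    vertex.  The base point moves like the vertex e_i, so that b.1 returns. *)
Lemma collapsedS (i : 'I_d.+1) : (0 < i)%N -> collapsed i -> collapsed i.+1.
Proof.
move=> i_gt0 coll e e0.
have i_neq0 : i != ord0 by rewrite -val_eqE /= -lt0n.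
have zero_neqi : (ord0 == i) = false by rewrite eq_sym (negPf i_neq0).
have e40 : 0 < e / 2 / 2 by rewrite !divr_gt0.
have [M [P [/nbhs_ballP[r /= r0 rP] MP]]] := b_tight e40.
pose K := [seq cube_dot m v |
  m : {ffun 'I_d.+1 -> int} <- M, v <- enum (cube d.+1)].
have [r1 r10 r1P] := iterz_equicontinuous T K cX e40.
have {}r1P m v x y : m \in M -> ball x r1 y ->
    ball (iterz T (cube_dot m v) x) (e / 2 / 2) (iterz T (cube_dot m v) y).
  by move=> mM; apply: r1P; apply/allpairsP; exists (m, v); rewrite mem_enum.
have [r2 r20 r2P] := iterz_equicontinuous S K cZ e40.
have {}r2P m v x y : m \in M -> ball x r2 y ->
    ball (iterz S (cube_dot m v) x) (e / 2 / 2) (iterz S (cube_dot m v) y).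
  by move=> mM; apply: r2P; apply/allpairsP; exists (m, v); rewrite mem_enum.
pose t := Num.min r (Num.min r1 r2).
have t0 : 0 < t by rewrite !lt_min r0 r10 r20.
have tr : t <= r by rewrite ge_min lexx.
have tr12 : t <= Num.min r1 r2 by rewrite ge_min lexx orbT.
have tr1 : t <= r1 by apply: le_trans tr12 _; rewrite ge_min lexx.
have tr2 : t <= r2 by apply: le_trans tr12 _; rewrite ge_min lexx orbT.
have [z [n [Az bz zP zQ]]] := coll t t0.
pose corner : cube d.+1 := [ffun j => (j == ord0) || (j == i)].
have [m mM mP] : exists2 m, m \in M & forall v : cube d.+1,
    ball b (e / 2 / 2) (iterz S (cube_dot
      (fun j => (if j == ord0 then - n ord0 else n j) + m j) v)
      (iterz S (n ord0 + n i) z)).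
  apply: MP; first exact: Ainv.
  have -> : n ord0 + n i = cube_dot n corner.
    rewrite (cube_dot_rebase i_neq0) ?ffunE ?eqxx ?orbT //.
    rewrite [X in _ = X + _](_ : _ = 0) ?add0r // /cube_dot big1 // => j _.
    rewrite !ffunE !eqxx /=; case: (j == ord0) => /=; first by rewrite mulr0.
    by case: (j == i); rewrite mulr0.
  apply: rP; apply: (le_ball tr); apply: zQ; exists ord0 => //.
  by rewrite ffunE eqxx.
pose mv v := cube_dot m (rebase i v).
have face (v : cube d.+1) : v i ->
    ball b (e / 2 / 2) (iterz S (mv v) (iterz S (cube_dot n v) z)).
  move=> vi; have := mP (rebase i v).
  rewrite (cube_dot_rebase i_neq0 n vi) -!iterzD cube_dotD [mv v + _]addrC.
  by rewrite addrAC.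
pose up (v : cube d.+1) : cube d.+1 := [ffun j => (j == i) || v j].
have upi v : up v i by rewrite ffunE eqxx.
have mv_up v : mv (up v) = mv v.
  congr cube_dot; apply/ffunP => j; rewrite !ffunE.
  by rewrite zero_neqi; case: (j == ord0); case: (j == i).
have nz (v : cube d.+1) j : v j -> v != cube0 d.+1.
  by move=> vj; apply: contraTneq vj => ->; rewrite ffunE.
exists (iterz S (m ord0) z), (rebase_dir i n m).
have moveE v : iterz S (cube_dot (rebase_dir i n m) v) (iterz S (m ord0) z) =
    iterz S (mv v) (iterz S (cube_dot n v) z).
  by rewrite -iterzD cube_dot_rebase_move // iterzD.
have small : e / 2 / 2 <= e.
  by apply: (@le_trans _ _ (e / 2));
    rewrite ler_pdivrMr // ler_pMr ?ler1n ?divr_gt0.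
split.
- exact: Ainv.
- pose ei : cube d.+1 := [ffun j => j == i].
  have eii : ei i by rewrite ffunE.
  have mvei : mv ei = m ord0.
    rewrite /mv /cube_dot (bigD1 ord0) //= !ffunE eqxx zero_neqi mulr1.
    rewrite big1 ?addr0 // => j /negPf j0; rewrite !ffunE j0.
    by case: (j == i); rewrite mulr0.
  have [+ _] := face _ eii.
  rewrite snd_iterz fst_iterz mvei => fe.
  apply: (ball_transfer (r := r1) (p := (iterz S (cube_dot n ei) z).1)) => //.
  + by move=> x y; rewrite -mvei; exact: r1P.
  + by apply: (le_ball tr1); apply: zP; exact: nz eii.
  + exact: le_ball tr1 _ bz.
- move=> v v0; rewrite moveE; have [+ _] := face _ (upi v).
  rewrite !(fst_iterz (mv _)) mv_up => fe.
  apply: (ball_transfer (r := r1) (p := (iterz S (cube_dot n (up v)) z).1)) => //.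
  + by move=> x y; exact: r1P.
  + by apply: (le_ball tr1); apply: zP; exact: nz (upi v).
  + by apply: (le_ball tr1); exact: zP.
- move=> v [j]; rewrite ltnS leq_eqVlt => /orP[/eqP/val_inj -> vi|ji vj].
    by rewrite moveE; apply: (le_ball small); exact: face.
  rewrite moveE; have := face _ (upi v); rewrite mv_up => fe.
  apply: (ball_transfer (r := r2) (p := iterz S (cube_dot n (up v)) z)) => //.
  + by move=> x y; exact: r2P.
  + by apply: (le_ball tr2); apply: zQ; exists j => //; rewrite ffunE vj orbT.
  + by apply: (le_ball tr2); apply: zQ; exists j.
Qed.

Lemma collapsed_all : collapsed d.+1.
Proof.
have coll k : (k <= d)%N -> collapsed k.+1.
  elim: k => [|k IH] kd; first exact: collapsed1.
  exact: (@collapsedS (Ordinal (kd : (k.+1 < d.+1)%N))) (IH (ltnW kd)).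
exact: coll.
Qed.

End CollapsingCubes.

(** * Flipping one vertex *)

Lemma prod_hausdorff (X Y : topologicalType) :
  hausdorff_space X -> hausdorff_space Y -> hausdorff_space (X * Y)%type.
Proof.
move=> hX hY p q pq; rewrite [p]surjective_pairing [q]surjective_pairing.
have cluster_comp (W : topologicalType) (f : X * Y -> W) :
    continuous f -> hausdorff_space W -> f p = f q.
  move=> cf hW; apply: hW => B C pB qC.
  by have [z [Bz Cz]] := pq _ _ (cf _ _ pB) (cf _ _ qC); exists (f z).
congr (_, _); apply: cluster_comp => //.
- by move=> z; exact: cvg_fst.
- by move=> z; exact: cvg_snd.
Qed.

Section FlippingVertices.
Variables (R : realType) (X : metricType R) (T : homeo X) (d : nat).
Notation S := (homeo_square T).
Variable A : set (X * X).
Hypotheses (cX : compact [set: X]) (Tmin : minimal_system T).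
Hypotheses (clA : closed A) (Amin : minimal_on S A).
Hypothesis Ainv : forall n z, A z -> A (iterz S n z).
Hypothesis A_RP : forall c, A c -> RP T d c.1 c.2.

(** Start from a cube of dimension d+1 all of whose vertices except the base z are
    close to b.  Shift it by k so that S^k z is near b, and apply recurrence at b
    to the half based at S^k z.  The vertices of the other half follow, being
    close to those of the first half; its base point is exempted, but its first
    coordinate stays close to the second coordinate of S^k z. *)
Lemma one_vertex_flip (V : set (X * X)) (V1 : set X) :
  open V -> open V1 -> A `&` V !=set0 -> (forall z, V z -> V1 z.2) ->
  exists (N : 'I_d -> int) (p0 p1 : X * X), [/\ A p0, A p1,
    forall v : cube d, V (iterz S (cube_dot N v) p0),
    forall v : cube d, v != cube0 d -> V (iterz S (cube_dot N v) p1) &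
    V1 p1.1].
Proof.
move=> oV oV1 AV VV1.
have hX : hausdorff_space X := @metric_hausdorff _ X.
have hZ := prod_hausdorff hX hX.
have cZ : compact [set: X * X] by rewrite -setXTT; exact: compact_setX.
have cA : compact A := subclosed_compact clA cZ (@subsetT _ _).
have A0 : A !=set0 by have [z [Az _]] := AV; exists z.
have fst_cont : continuous (@fst X X) by move=> z; exact: cvg_fst.
have fst_iterz n z : (iterz S n z).1 = iterz T n z.1 by rewrite iterz_square.
have [b [Ab Vb bU bO]] := good_point_exists hZ cZ clA Amin Ainv d.+1 hX
  fst_cont fst_iterz (factor_onto hX cA A0 Ainv fst_cont fst_iterz Tmin) oV AV.
have coll := collapsed_all cX Tmin clA Amin Ainv A_RP Ab bU bO.
have /nbhs_ballP[e1 /= e10 e1V] : nbhs b V by exact: open_nbhs_nbhs.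
have /nbhs_ballP[e2 /= e20 e2V] : nbhs b.2 V1.
  by apply: open_nbhs_nbhs; split => //; exact: VV1.
pose e := Num.min e1 e2.
have e0 : 0 < e by rewrite lt_min e10 e20.
have {}e1V : ball b e `<=` V.
  by apply: subset_trans e1V; apply: le_ball; rewrite ge_min lexx.
have {}e2V : ball b.2 e `<=` V1.
  by apply: subset_trans e2V; apply: le_ball; rewrite ge_min lexx orbT.
have eh0 : 0 < e / 2 by rewrite divr_gt0.
have ehe : e / 2 <= e by rewrite ler_pdivrMr // ler_pMr // ler1n.
have [M [P [bP MP]]] := bU _ eh0.
pose Q := P° `&` (ball b (e / 2))°.
have [||K KP] := @minimal_set_syndetic _ S A Amin Q cA.
- by apply: openI; exact: open_interior.
- exists b; split => //; split.
    exact: nbhs_singleton (nbhs_interior bP).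
  exact: nbhs_singleton (nbhs_interior (nbhsx_ballx _ _ eh0)).
pose KM := K ++ [seq k + c | k <- K, c <-
  [seq cube_dot m v | m : {ffun 'I_d.+1 -> int} <- M, v <- enum (cube d.+1)]].
have [r r0 rP] := iterz_equicontinuous T KM cX eh0.
have [r' r'0 r'P] := iterz_equicontinuous S KM cZ eh0.
pose t := Num.min r r' / 2.
have t0 : 0 < t by rewrite divr_gt0 // lt_min r0 r'0.
have tr : t + t <= r by rewrite -splitr ge_min lexx.
have tr' : t + t <= r' by rewrite -splitr ge_min lexx orbT.
have [z [n [Az bz _ zQ]]] := coll t t0.
have face (v : cube d.+1) : v != cube0 d.+1 ->
    ball b t (iterz S (cube_dot n v) z).
  move=> v0; apply: zQ; apply: contrapT => nv; case/eqP: v0; apply/ffunP => j.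
  by rewrite ffunE; apply/negP => vj; apply: nv; exists j.
have [k kK [/interior_subset kP /interior_subset kb]] := KP z Az.
have [m mM mP] := MP _ (Ainv k Az) kP n.
pose N j := n (lift ord0 j) + m (lift ord0 j).
have NE (v : cube d) w : iterz S (cube_dot N v) (iterz S k w) =
    iterz S (k + cube_dot m (cube_cons false v))
      (iterz S (cube_dot n (cube_cons false v)) w).
  rewrite -!iterzD !cube_dot_cons !add0r /N cube_dotD; congr (iterz S _ w).
  by rewrite addrC -addrA [cube_dot _ v + _]addrC.
have shiftE w : iterz S (n ord0) w =
    iterz S (cube_dot n (cube_cons true (cube0 d))) w.
  by rewrite cube_dot_cons cube_dot0r addr0.
have true_neq0 (v : cube d) : cube_cons true v != cube0 d.+1.
  by rewrite cube_cons_neq0.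
exists N, (iterz S k z), (iterz S k (iterz S (n ord0) z)).
have p0P v : ball b (e / 2) (iterz S (cube_dot N v) (iterz S k z)).
  have := mP (cube_cons false v); congr (ball b _ (iterz S _ _)).
  by rewrite cube_dot_cons add0r.
split.
- exact: Ainv.
- by do 2 apply: Ainv.
- by move=> v; apply: e1V; apply: (le_ball ehe).
- move=> v v0; apply: e1V; apply: (ball_split (p0P v)); rewrite !NE.
  apply: r'P.
    rewrite mem_cat; apply/orP; right; apply/allpairsP.
    exists (k, cube_dot m (cube_cons false v)); split => //=.
    by apply/allpairsP; exists (m, cube_cons false v); rewrite mem_enum.
  rewrite -iterzD (_ : _ + n ord0 = cube_dot n (cube_cons true v)); last first.
    by rewrite !cube_dot_cons add0r addrC.
  apply: (le_ball tr'); apply: (@ball_triangle _ _ b).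
    by apply: ball_sym; apply: face; rewrite cube_cons_neq0.
  exact: face.
- apply: e2V; rewrite !fst_iterz.
  have [_] := kb; rewrite iterz_square /= => kb2.
  apply: (ball_split kb2); apply: rP; first by rewrite mem_cat kK.
  apply: (le_ball tr); apply: (@ball_triangle _ _ b.1); first exact: ball_sym.
  by have [+ _] := face _ (true_neq0 (cube0 d)); rewrite -shiftE fst_iterz.
Qed.

Lemma cube_dot_reflect (N : 'I_d -> int) (e v : cube d) :
  cube_dot (fun j => if e j then - N j else N j) v + cube_dot N e =
  cube_dot N [ffun j => v j (+) e j].
Proof.
rewrite /cube_dot -big_split; apply: eq_bigr => j _ /=; rewrite ffunE.
by case: (e j); case: (v j) => /=; ring.
Qed.

Variable a : X * X.
Hypothesis Aa : A a.

(** Reversing the directions in which e is 1 carries the exceptional vertex from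
    0 to e.  The cubes are then moved into the orbit of a by minimality. *)
Lemma vertex_flip (e : cube d) (V0 V1 : set X) :
  nbhs a.1 V0 -> nbhs a.2 V1 ->
  exists N : 'I_d -> int, forall c : bool, exists l : int,
    (forall v, v != e -> V0 (iterz T (cube_dot N v) (iterz T l a.1)) /\
                         V1 (iterz T (cube_dot N v) (iterz T l a.2))) /\
    (if c then V1 else V0) (iterz T (cube_dot N e) (iterz T l a.1)).
Proof.
move=> aV0 aV1.
pose V := fst @^-1` V0° `&` (@snd X X) @^-1` V1°.
have oV : open V.
  apply: openI; apply: open_comp => [z _|].
  - exact: cvg_fst.
  - exact: open_interior.
  - exact: cvg_snd.
  - exact: open_interior.
have [||N [p0 [p1 [Ap0 Ap1 p0P p1P p1V]]]] :=
  @one_vertex_flip V V1° oV (@open_interior _ _).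
- by exists a; split => //; split; exact: nbhs_singleton (nbhs_interior _).
- by move=> z [].
exists (fun j => if e j then - N j else N j) => c.
(* The base point S^(N.e) p turns the vertex v into the vertex v xor e. *)
pose Ne := fun j => if e j then - N j else N j.
pose p := if c then p1 else p0.
have Ap : A (iterz S (cube_dot N e) p) by apply: Ainv; rewrite /p; case: (c).
have [|l lP] := @minimal_set_visits _ S A Amin a (iterz S (cube_dot N e) p)
  [set u | forall v, (v != e -> V (iterz S (cube_dot Ne v) u)) /\
    (v == e -> ((@fst X X) @^-1` (if c then V1 else V0)°)
                 (iterz S (cube_dot Ne v) u))] Aa Ap.
  apply: nbhs_forall => v.
  have reflE : iterz S (cube_dot Ne v) (iterz S (cube_dot N e) p) =
      iterz S (cube_dot N [ffun j => v j (+) e j]) p.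
    by rewrite -iterzD cube_dot_reflect.
  have [->|ve] := eqVneq v e.
    suff : nbhs (iterz S (cube_dot N e) p) (iterz S (cube_dot Ne e) @^-1`
        ((@fst X X) @^-1` (if c then V1 else V0)°)).
      by apply: filterS => u uV; split.
    apply: (@iterz_continuous _ S (cube_dot Ne e)); apply: open_nbhs_nbhs; split.
      by apply: open_comp => [z _|]; [exact: cvg_fst|exact: open_interior].
    rewrite /= -iterzD cube_dot_reflect.
    have -> : [ffun j => e j (+) e j] = cube0 d.
      by apply/ffunP => j; rewrite !ffunE addbb.
    rewrite cube_dot0r /p; case: (c) => //=.
    by have := p0P (cube0 d); rewrite cube_dot0r => -[].
  suff : nbhs (iterz S (cube_dot N e) p) (iterz S (cube_dot Ne v) @^-1` V).
    by apply: filterS => u uV; split.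
  apply: (@iterz_continuous _ S (cube_dot Ne v)); apply: open_nbhs_nbhs; split => //.
  rewrite reflE /p; case: (c); last exact: p0P.
  apply: p1P; apply: contra ve => /eqP/ffunP ve; apply/eqP/ffunP => j.
  by have := ve j; rewrite !ffunE; case: (v j); case: (e j).
exists l; split=> [v ve|].
  have [/(_ ve) + _] := lP v.
  by rewrite !iterz_square => -[/interior_subset ? /interior_subset].
have [_ /(_ (eqxx e))] := lP e.
by rewrite /= !iterz_square => /interior_subset.
Qed.

End FlippingVertices.

(** * Superposing flips *)

Section IndependentCubes.
Variables (R : realType) (X : metricType R) (T : homeo X) (d : nat).
Variables (x0 x1 : X).
Hypothesis flip : forall (e : cube d) (V0 V1 : set X),
  nbhs x0 V0 -> nbhs x1 V1 ->
  exists N : 'I_d -> int, forall c : bool, exists l : int,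
    (forall v, v != e -> V0 (iterz T (cube_dot N v) (iterz T l x0)) /\
                         V1 (iterz T (cube_dot N v) (iterz T l x1))) /\
    (if c then V1 else V0) (iterz T (cube_dot N e) (iterz T l x0)).

Let pull_nbhs (n : int) (x : X) (V : set X) : open V -> V (iterz T n x) ->
  nbhs x (iterz T n @^-1` V).
Proof. by move=> oV Vx; apply: iterz_continuous; exact: open_nbhs_nbhs. Qed.

(** Vertices outside E keep both coordinates of the pair close to (x0, x1); this
    is what allows them to be flipped later. *)
Definition realized (k : nat) (E : seq ('I_k * cube d)) (V0 V1 : set X)
    (p : 'I_k -> 'I_d -> int) (s : 'I_k * cube d -> bool) (l : int) :=
  [/\ V0 (iterz T l x0), V1 (iterz T l x1),
    forall u, u \notin E ->
      V0 (iterz T (cube_dot (p u.1) u.2) (iterz T l x0)) /\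
      V1 (iterz T (cube_dot (p u.1) u.2) (iterz T l x1)) &
    forall u, u \in E ->
      (if s u then V1 else V0) (iterz T (cube_dot (p u.1) u.2) (iterz T l x0))].

(** Induction on E.  The patterns on E realized at the times l s are open
    conditions V0', V1' on x0, x1; a flip at the new vertex e inside V0', V1', used
    for the cube number e.1 only, keeps them all and adds the choice at e. *)
Lemma independent_cubes (k : nat) (E : seq ('I_k * cube d)) (V0 V1 : set X) :
  (forall u, u \in E -> u.2 != cube0 d) ->
  open V0 -> open V1 -> V0 x0 -> V1 x1 ->
  exists p : 'I_k -> 'I_d -> int, forall s : 'I_k * cube d -> bool,
    exists l : int, realized E V0 V1 p s l.
Proof.
move=> E0 oV0 oV1 V0x V1x.
elim: E E0 => [|e E IH] E0.
  exists (fun _ _ => 0) => s; exists 0; split => // u _.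
  by rewrite cube_dot0l.
have {}IH := IH (fun u uE => E0 u (mem_behead (uE : u \in behead (e :: E)))).
have e0 : e.2 != cube0 d by apply: E0; rewrite mem_head.
have [p pP] := IH; have [eE|eE] := boolP (e \in E).
  exists p => s; have [l [lx0 lx1 lN lE]] := pP s; exists l; split => //.
    by move=> u; rewrite inE negb_or => /andP[_ /lN].
  by move=> u; rewrite inE => /orP[/eqP ->|]; exact: lE.
have /choice[l lP] : forall s : {ffun 'I_k * cube d -> bool}, exists l : int,
  realized E V0 V1 p s l by move=> s; exact: pP.
pose F s u := cube_dot (p u.1) u.2 + l s.
pose V0' := [set y | forall s, V0 (iterz T (l s) y) /\ forall u,
  (if (u \in E) && s u then V1 else V0) (iterz T (F s u) y)].
pose V1' := [set y | forall s, V1 (iterz T (l s) y) /\ forall u, u \notin E ->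
  V1 (iterz T (F s u) y)].
have xV0' : nbhs x0 V0'.
  apply: nbhs_forall => s0.
  have [lx0 lx1 lN lE] := lP s0.
  apply: filterI; first exact: pull_nbhs.
  apply: nbhs_forall => u.
  have [uE|uE] := boolP (u \in E).
    apply: (@pull_nbhs (F s0 u) x0); first by case: ifP.
    by rewrite /F iterzD; exact: lE.
  by apply: (@pull_nbhs (F s0 u) x0) => //=; rewrite /F iterzD; have [] := lN u uE.
have xV1' : nbhs x1 V1'.
  apply: nbhs_forall => s0.
  have [lx0 lx1 lN lE] := lP s0.
  apply: filterI; first exact: pull_nbhs.
  apply: nbhs_forall => u.
  have [uE|uE] := boolP (u \in E); first by apply: nearW.
  have : nbhs x1 (iterz T (F s0 u) @^-1` V1).
    by apply: pull_nbhs => //; rewrite /F iterzD; have [] := lN u uE.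
  by apply: filterS.
have [N NP] := flip e.2 xV0' xV1'.
pose q (i : 'I_k) (j : 'I_d) : int := p i j + (if i == e.1 then N j else 0).
exists q => s; pose t := [ffun u => s u].
have [l' [l'N l'e]] := NP (s e).
have base : V0' (iterz T l' x0) /\ V1' (iterz T l' x1).
  by have := l'N (cube0 d); rewrite cube_dot0r /= eq_sym => /(_ e0).
pose y u z := if u.1 == e.1 then iterz T (cube_dot N u.2) (iterz T l' z)
              else iterz T l' z.
have yE u z : iterz T (cube_dot (q u.1) u.2) (iterz T (l t + l') z) =
    iterz T (F t u) (y u z).
  rewrite /q cube_dotD /y /F; case: (u.1 == e.1).
    rewrite -!iterzD; congr (iterz T _ z).
    by rewrite -!addrA; congr (_ + _); rewrite addrCA.
  by rewrite cube_dot0l addr0 iterzD -iterzD -iterzD.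
have yV u : u != e -> V0' (y u x0) /\ V1' (y u x1).
  move=> ue; rewrite /y; case: eqP => // u1; apply: l'N.
  apply: contra ue => /eqP u2.
  by rewrite [u]surjective_pairing u1 u2 -surjective_pairing.
exists (l t + l'); split.
- by rewrite iterzD; have [/(_ t)[]] := base.
- by rewrite iterzD; have [_ /(_ t)[]] := base.
- move=> u; rewrite inE negb_or => /andP[ue uE]; rewrite !yE.
  have [/(_ t)[_ /(_ u) +] /(_ t)[_ /(_ u uE)]] := yV u ue.
  by rewrite (negPf uE).
- move=> u; rewrite inE => /orP[/eqP ->|uE].
    rewrite yE /y eqxx; case: (s e) l'e => /(_ t)[_ /(_ e)].
      exact.
    by rewrite (negPf eE).
  have ue : u != e by apply: contraNneq eE => <-.
  by rewrite yE; have [/(_ t)[_ /(_ u)]] := yV u ue; rewrite uE /t ffunE.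
Qed.

End IndependentCubes.

(** * Minimal regionally proximal pairs are independent *)

Theorem lemma5p4 (R : realType) (X : metricType R) (T : homeo X) (d : nat)
    (x0 x1 : X)
    (X_compact : compact [set: X])
    (T_minimal : minimal_system T)
    (d_gt0 : (0 < d)%N)
    (x01_RP : RP T d x0 x1)
    (x01_neq : x0 <> x1)
    (x01_minimal : minimal_point (homeo_square T) (x0, x1)) :
  IN_pair T d x0 x1.
Proof.
pose S := homeo_square T.
pose A := closure (orbitz S (x0, x1)).
have Aa : A (x0, x1) by apply: subset_closure; exists 0.
have Ainv n z : A z -> A (iterz S n z).
  move=> Az B /(iterz_continuous (x := z))/Az[_ [[m _ <-] Bm]].
  exists (iterz S n (iterz S m (x0, x1))); split => //.
  by exists (n + m) => //; exact: iterzD.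
have A_RP c : A c -> RP T d c.1 c.2 by exact: RP_orbit_closure.
have flip := vertex_flip X_compact T_minimal (@closed_closure _ _) x01_minimal
  Ainv A_RP Aa.
move=> k k_gt0 U0 U1 xU0 xU1.
have [V0 [V1 [[oV0 V0x V0U] [oV1 V1x V1U] V01]]] : exists V0 V1,
    [/\ [/\ open V0, V0 x0 & V0 `<=` U0], [/\ open V1, V1 x1 & V1 `<=` U1] &
        V0 `&` V1 = set0].
  have /eqP x01 := x01_neq.
  have := @metric_hausdorff _ X; rewrite open_hausdorff => /(_ _ _ x01).
  case=> -[B C] /= [/set_mem Bx /set_mem Cx] [oB oC BC].
  exists (B `&` U0°), (C `&` U1°); split.
  - split; [by apply: openI => //; exact: open_interior| |].
      by split => //; exact: nbhs_singleton (nbhs_interior xU0).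
    by move=> y [_ /interior_subset].
  - split; [by apply: openI => //; exact: open_interior| |].
      by split => //; exact: nbhs_singleton (nbhs_interior xU1).
    by move=> y [_ /interior_subset].
  - rewrite -subset0 => y [[By _] [Cy _]].
    by have : (B `&` C) y by []; rewrite (eqP BC).
have disj y : V0 y -> V1 y -> False.
  by move=> V0y V1y; have : (V0 `&` V1) y by []; rewrite V01.
pose E := [seq u <- enum {: 'I_k * cube d} | u.2 != cube0 d].
have EE u : (u \in E) = (u.2 != cube0 d) by rewrite mem_filter mem_enum andbT.
have [|p pP] := independent_cubes flip (E := E) _ oV0 oV1 V0x V1x.
  by move=> u; rewrite EE.
exists p => D q; split.
- move=> u Du; apply/eqP => qu.
  have [l [lx0 _ _ lE]] := pP xpredT.
  have := lE u; rewrite EE -/(q u) qu => /(_ Du); exact: disj.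
- move=> u v Du Dv quv; apply: contrapT => uv.
  have [l [_ _ _ lE]] := pP (fun w => w == u).
  have := lE u; have := lE v; rewrite !EE -/(q u) -/(q v) quv eqxx.
  rewrite (_ : (v == u) = false); last by apply/eqP => vu; exact: uv.
  by move=> /(_ Dv) V0v /(_ Du) /(disj _ V0v).
- move=> J _ _ JD s; have [l [_ _ _ lE]] := pP (fun u => s (q u)).
  exists (iterz T l x0) => j /JD[u Du quj] /=.
  have := lE u; rewrite EE -/(q u) quj => /(_ Du).
  by case: ifP => _; [exact: V1U|exact: V0U].
Qed.
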